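(* Let $p$ be a prime and let $a,b$ be two positive integers. Then the function $S(n)=F_{an+b}$ is an LP function with the prime $p$ if and only if $$F_{a}\equiv 0 \pmod p \quad\text{and}\quad F_{b}\equiv 1 \pmod p.$$
   Context: $F_n$ denotes the Fibonacci sequence: $F_0=0$, $F_1=1$, $F_n=F_{n-1}+F_{n-2}$ for $n\ge 2$. An arithmetic function $S:\mathbb{Z}_{\ge 0}\to\mathbb{Z}$ is an LP function with the prime $p$ (has the Lucas property with the prime $p$) if for every nonnegative integer $n=\sum_{i=0}^{r}n_i p^i$ with base-$p$ digits $0\le n_i\le p-1$, one has $S(n)\equiv S(n_0)S(n_1)\cdots S(n_r)\pmod p$.
   Formalization: The formal theorem also assumes that S(n)=F_{an+b} is not identically 0 mod p; without this the claim fails, e.g. p=2, a=b=3, where every F_{3n+3} is even, so S is trivially an LP function although F_b is not 1 mod p. *)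

(* Defs.v *)
From HB Require Import structures.
From mathcomp Require Import all_boot all_order all_algebra.

Set Implicit Arguments.
Unset Strict Implicit.
Unset Printing Implicit Defensive.

Fixpoint fib (n : nat) : nat :=
  if n is m.+1 then
    if m is k.+1 then fib m + fib k else 1
  else 0.

(* The expansion is d_0 + d_1 p + ... + d_r p^r.  The definition puts no
   condition on the top digit, so zeros may be appended to an expansion. *)
Definition LP_function (p : nat) (S : nat -> int) : Prop :=
  forall (n r : nat) (d : nat -> nat),
    (forall i, i <= r -> d i <= p - 1) ->
    n = \sum_(0 <= i < r.+1) d i * p ^ i ->
    (S n = (\prod_(0 <= i < r.+1) S (d i))%R %[mod p])%Z.

(* The zero function is trivially an LP function with p.  It occurs among the
   functions F_(an+b) modulo p exactly when p divides both F_a and F_b, for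
   instance when p = 2 and a = b = 3. *)
Definition vanishes_mod (p : nat) (S : nat -> int) : Prop :=
  forall n : nat, (S n = 0 %[mod p])%Z.

(* Main.v *)
(** Modulo p, the Lucas property of S(n) = F_(an+b) forces S(0) = 1 unless S
    vanishes, and then S(p) = S(1) = s, S(p+1) = s^2 and S(2p) = S(2).  Vajda's
    identity F_(m+i) F_(m+j) - F_m F_(m+i+j) = (-1)^m F_i F_j at m = b gives, up
    to sign, F_a F_(ap) = S(1) S(p) - S(p+1) = 0 and
    F_(ap)^2 = s^2 - S(2p) = s^2 - S(2) = F_a^2, so F_a^4 = 0.  Conversely, if
    F_a = 0 and F_b = 1 then S(n) = F_(a-1)^n, and Fermat's little theorem
    makes this compatible with base-p digits. *)

Require Import Defs.
From HB Require Import structures.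
From mathcomp Require Import all_boot all_order all_algebra.
From mathcomp Require Import finfield ring.

Import GRing.Theory.

Lemma fibSS n : fib n.+2 = fib n.+1 + fib n.
Proof. by []. Qed.

Lemma fib_addS m n : fib (m + n).+1 = fib m.+1 * fib n.+1 + fib m * fib n.
Proof.
elim: m n => [|m IHm] n; first by rewrite add0n mul1n mul0n addn0.
rewrite addSnnS IHm fibSS (fibSS m) !mulnDl !mulnDr.
by rewrite addnAC.
Qed.

(** The left sides at [m] and [m.+1] add up to zero: by [fib_addS], both ways of splitting the
    index, [(m + i) + (m + j)] and [m + (m + i + j)], expand the same Fibonacci number. Hence each
    step of the induction only flips the sign. *)
Lemma vajda (R : comNzRingType) m i j :
  ((fib (m + i))%:R * (fib (m + j))%:R - (fib m)%:R * (fib (m + i + j))%:R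
   = (-1) ^+ m * (fib i)%:R * (fib j)%:R :> R)%R.
Proof.
elim: m => [|m IHm]; first by rewrite !add0n mul0r subr0 mul1r.
rewrite exprS !mulN1r !mulNr -IHm.
have eq_sum : (m + i) + (m + j) = m + (m + i + j) by rewrite addnACA !addnA.
have /(congr1 (fun n => n%:R : R)%R) := fib_addS (m + i) (m + j).
rewrite eq_sum fib_addS !natrD !natrM !addSn => eq_fib.
apply/eqP; rewrite -subr_eq0; move/eqP: eq_fib; rewrite eq_sym -subr_eq0.
by congr (_ == _); ring.
Qed.

Lemma eqz_mod_Fp (p : nat) (m n : int) : prime p ->
  (m = n %[mod p])%Z <-> (m%:~R = n%:~R :> 'F_p)%R.
Proof.
move=> p_pr; split=> [/eqP | eq_mn].
  by rewrite eqz_mod_dvd (dvdz_pcharf (pchar_Fp p_pr)) rmorphB subr_eq0 => /eqP.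
by apply/eqP; rewrite eqz_mod_dvd (dvdz_pcharf (pchar_Fp p_pr)) rmorphB /= eq_mn subrr.
Qed.

Lemma eqn_mod_Fp (p m n : nat) : prime p ->
  m = n %[mod p] <-> (m%:R = n%:R :> 'F_p)%R.
Proof.
move=> p_pr; rewrite !pmulrn -eqz_mod_Fp //.
by rewrite !modz_nat; split=> [-> | []].
Qed.

Lemma fermat_Fp (p : nat) (x : 'F_p) : prime p -> (x ^+ p)%R = x.
Proof. by move=> p_pr; rewrite -[RHS]expf_card card_Fp. Qed.

Lemma digit_expansion p n r :
  n = \sum_(0 <= i < r) n %/ p ^ i %% p * p ^ i + n %/ p ^ r * p ^ r.
Proof.
elim: r => [|r IHr]; first by rewrite big_geq // expn0 divn1 muln1.
rewrite big_nat_recr //= -addnA {1}IHr; congr (_ + _).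
by rewrite expnSr divnMA (mulnC (p ^ r) p) mulnA -mulnDl addnC -divn_eq.
Qed.

(** Once $F_a = 0$, the addition formula $F_{k+a} = F_{k+1} F_a + F_k F_{a-1}$ makes a shift by [a]
    a multiplication by $F_{a-1}$. *)
Lemma fib_progression (R : comNzRingType) a b n : 0 < a ->
  ((fib a)%:R = 0 :> R)%R ->
  ((fib (a * n + b))%:R = (fib a.-1)%:R ^+ n * (fib b)%:R :> R)%R.
Proof.
case: a => // a _ Fa0; elim: n => [|n IHn]; first by rewrite muln0 mul1r.
rewrite mulnS -addnA addnC addnS fib_addS natrD !natrM Fa0 IHn.
by rewrite exprS /=; ring.
Qed.

Section LucasModP.

Variables (p a b : nat).
Hypotheses (p_pr : prime p) (a_gt0 : 0 < a).

Local Notation f n := ((fib (a * n + b))%:R : 'F_p)%R.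
Local Notation S := (fun n : nat => Posz (fib (a * n + b))).

(** Over the field ['F_p] the congruences become equations, and zero divisors are excluded. *)
Lemma LP_Fp : LP_function p S <->
  forall n r (d : nat -> nat), (forall i, i <= r -> d i <= p - 1) ->
    n = \sum_(0 <= i < r.+1) d i * p ^ i -> (f n = \prod_(0 <= i < r.+1) f (d i))%R.
Proof.
by split=> LP n r d dP nE; have := LP n r d dP nE; rewrite eqz_mod_Fp // rmorph_prod.
Qed.

Lemma LP_fib_sufficient :
  (fib a)%:R%R = 0%R :> 'F_p -> (fib b)%:R%R = 1%R :> 'F_p -> LP_function p S.
Proof.
move=> Fa0 Fb1; apply/LP_Fp => n r d _ ->.
have fE m : f m = ((fib a.-1)%:R ^+ m)%R.
  by rewrite fib_progression // Fb1 mulr1.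
rewrite fE expr_sum; apply: eq_bigr => i _; rewrite fE mulnC exprM.
(* Iterating Fermat gives $c^{p^i} = c$ for $c = F_{a-1}$. *)
by congr (_ ^+ _)%R; elim: i => // i IHi; rewrite expnSr exprM IHi fermat_Fp.
Qed.

Lemma LP_fib_necessary : ~ vanishes_mod p S -> LP_function p S ->
  (fib a)%:R%R = 0%R :> 'F_p /\ (fib b)%:R%R = 1%R :> 'F_p.
Proof.
move=> nvS /LP_Fp LP; have p_gt1 := prime_gt1 p_pr.
have p_gt0 := ltnW p_gt1.
have two n0 n1 : n0 < p -> n1 < p -> f (n0 + n1 * p) = (f n0 * f n1)%R.
  move=> lt0 lt1; have := LP (n0 + n1 * p) 1 (fun i => if i is 0 then n0 else n1).
  rewrite !big_nat_recl // !big_geq //= muln1 expn1 addn0 mulr1; apply=> //.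
  by case=> [|i] _; rewrite subn1 -ltnS prednK.
have f0 : f 0 = 1%R.
  have [// | f0N1] := eqVneq (f 0) 1%R; case: nvS => n.
  have f_small m : m < p -> f m = 0%R.
    (* A leading zero digit gives $f(m) = f(m) f(0)$, so $f(0) \ne 1$ kills $f$ on every digit,
       hence everywhere. *)
    move=> lt_mp; have /eqP := two m 0 lt_mp p_gt0; rewrite mul0n addn0.
    rewrite -subr_eq0 -{1}[f m]mulr1 -mulrBr mulf_eq0 subr_eq0.
    by rewrite (eq_sym 1%R) (negPf f0N1) orbF => /eqP.
  apply/eqz_mod_Fp => //; rewrite -pmulrn.
  rewrite (LP n n (fun i => n %/ p ^ i %% p)).
  - by rewrite big_nat_recl //= f_small ?mul0r // ltn_mod.
  - by move=> i _; rewrite subn1 -ltnS prednK // ltn_mod.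
  (* Since $n < p^n < p^{n+1}$, digits 0 to [n] exhaust [n]. *)
  rewrite {1}(digit_expansion p n n.+1) divn_small ?mul0n ?addn0 //.
  by apply: (ltn_trans (ltn_expl n p_gt1)); rewrite ltn_exp2l.
have Fb1 : (fib b)%:R%R = 1%R :> 'F_p by have := f0; rewrite muln0.
have fp : f p = f 1 by have := two 0 1 p_gt0 p_gt1; rewrite mul1n f0 mul1r.
have fSp : f p.+1 = (f 1 * f 1)%R by rewrite -(two 1 1) // mul1n.
have f2p : f (2 * p) = f 2.
  have [p_gt2 | p_le2] := ltnP 2 p.
    by have := two 0 2 p_gt0 p_gt2; rewrite f0 mul1r.
  have p2 : p = 2 by apply/eqP; rewrite eqn_leq p_le2.
  (* For $p = 2$ the number 2 is not a digit; instead $2p = 4$ has binary digits 0, 0, 1, so $f(4) =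
     f(1) = f(p) = f(2)$. *)
  have := LP (2 * p) 2 (fun i => i == 2); rewrite !big_nat_recl // !big_geq //=.
  rewrite f0 !mul0n !mul1n !mul1r mulr1 -fp p2; apply=> //.
  by move=> i _; case: (i == 2).
split=> //; apply/eqP.
have V i j : ((f i * f j - f (i + j))%R
    = (-1) ^+ b * (fib (a * i))%:R * (fib (a * j))%:R :> 'F_p)%R.
  have := vajda 'F_p b (a * i) (a * j); rewrite Fb1 mul1r => <-.
  by rewrite -addnA -mulnDr !(addnC b).
(* Either $F_a = 0$ at once, or $F_{ap} = 0$; in the latter case [V p p] and [V 1 1] have the same
   left side, so $F_a^2 = 0$. *)
have := V 1 p; rewrite add1n fp fSp subrr muln1 => /esym/eqP.
rewrite -mulrA mulf_eq0 signr_eq0 /= mulf_eq0 => /orP[// | /eqP Fap0].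
have := V p p; rewrite addnn -mul2n f2p fp Fap0 mulr0.
have := V 1 1; rewrite muln1 => -> /eqP.
by rewrite -mulrA mulf_eq0 signr_eq0 /= mulf_eq0 orbb.
Qed.

End LucasModP.

Theorem theorem1 (p a b : nat) (hp : prime p) (ha : 0 < a) (hb : 0 < b)
    (hS : ~ vanishes_mod p (fun n : nat => Posz (fib (a * n + b)))) :
  LP_function p (fun n : nat => Posz (fib (a * n + b))) <->
  fib a = 0 %[mod p] /\ fib b = 1 %[mod p].
Proof.
rewrite !eqn_mod_Fp //; split; first exact: LP_fib_necessary.
by case; exact: LP_fib_sufficient.
Qed.
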